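(* Let $A$, $\Omega=\bigcup_{i=1}^m\Omega_i$, $\mathcal{E}$, $W$, $M$, $\widehat{A}$ be as defined in the context, and assume that $A$ and $-W$ are symmetric positive definite. Let $\Lambda\subset\mathbb{R}^{\mathcal{E}}$ be a subspace with $\dim(\Lambda)=r$, let $Z\in\mathbb{R}^{|\mathcal{E}|\times r}$ satisfy $\mathrm{range}(Z)=\Lambda$, and let $$Q:=\begin{pmatrix}\frac14\widehat{A} & M^TWZ\\ Z^TWM & -Z^TWZ\end{pmatrix}.$$ Then, for any $p\in\mathbb{R}^{\Omega}$ and any $\eta\in\mathbb{R}^r$, $$\begin{pmatrix}p\\ \eta\end{pmatrix}^TQ\begin{pmatrix}p\\ \eta\end{pmatrix}=\frac14\,p^TAp-(\lambda-Mp)^TW(\lambda-Mp),\qquad \lambda=Z\eta.$$ In particular, $Q$ is symmetric positive definite.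
   Context: Let $A=(a_{kl})\in\mathbb{R}^{N\times N}$ be a symmetric matrix, with rows and columns indexed by $\Omega=\{1,\dots,N\}$. Let $\Omega=\bigcup_{i=1}^m\Omega_i$ be a partition into $m$ pairwise disjoint subsets (subdomains), with the indices ordered so that those of $\Omega_1,\Omega_2,\dots,\Omega_m$ are consecutive. $A_{ij}$ denotes the submatrix of $A$ with rows in $\Omega_i$ and columns in $\Omega_j$; for $i\ne j$ write $i\sim j$ if $A_{ij}\neq0$. For finite sets $X,Y$, $\mathbb{R}^X$ denotes real vectors indexed by $X$ and $\mathbb{R}^{X\times Y}$ real matrices with rows indexed by $X$ and columns by $Y$. Interface edges: $\mathcal{E}$ is the set of pairs $(k,l)$ with $k\in\Omega_i$, $l\in\Omega_j$ for some $i<j$ and $a_{kl}\ne0$. $W\in\mathbb{R}^{\mathcal{E}\times\mathcal{E}}$ is the diagonal matrix with entry $a_{kl}$ at $e=(k,l)\in\mathcal{E}$. The averaging matrix $M\in\mathbb{R}^{\mathcal{E}\times\Omega}$ is given by $(Mp)_e=\frac{p_k+p_l}{2}$ for $e=(k,l)\in\mathcal{E}$, $p\in\mathbb{R}^\Omega$. For $i\sim j$ let $D_{ij}=\mathrm{diag}(A_{ij}\mathbf{1}_{\Omega_j})$ (diagonal matrix indexed by $\Omega_i$ whose $k$-th diagonal entry is $\sum_{l\in\Omega_j}a_{kl}$), let $A_i=A_{ii}-\sum_{j:\,j\sim i}D_{ij}$, and let $\widehat{A}=\mathrm{diag}(A_1,\dots,A_m)\in\mathbb{R}^{\Omega\times\Omega}$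 (block diagonal). *)

(* Defs.v *)
From mathcomp Require Import all_boot all_order all_algebra.
From mathcomp Require Import reals.

Set Implicit Arguments.
Unset Strict Implicit.
Unset Printing Implicit Defensive.

Import Order.TTheory GRing.Theory Num.Theory.

Local Open Scope ring_scope.

Section PositiveDefinite.
Variables (R : realType) (n : nat).

Definition qform (B : 'M[R]_n) (x : 'cV[R]_n) : R := (x^T *m B *m x) 0 0.

Definition spd (B : 'M[R]_n) : Prop :=
  B^T = B /\ forall x : 'cV[R]_n, x != 0 -> 0 < qform B x.

End PositiveDefinite.

(* A partition of the index set into m consecutive subdomains is given by the
   sizes [n i] of its blocks, following the block matrices of [matrix.v]: the
   index set is ['I_(\sum_i n i)], and [tagnat.sig1 k] is the block of [k]. *)
Section Subdomains.
Variables (m : nat) (n : 'I_m -> nat).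

Definition subdomain (i : 'I_m) : {set 'I_(\sum_i n i)%N} :=
  [set k | tagnat.sig1 k == i].

Lemma subdomain_cover : \bigcup_i subdomain i = [set: 'I_(\sum_i n i)%N].
Proof.
apply/setP=> k; rewrite inE; apply/bigcupP.
by exists (tagnat.sig1 k); rewrite ?inE.
Qed.

Lemma subdomain_disjoint (i j : 'I_m) :
  i != j -> [disjoint subdomain i & subdomain j].
Proof.
move=> neq_ij; apply/pred0P=> k /=; rewrite !inE.
by apply/negP=> /andP[/eqP-> /eqP eq_ij]; rewrite eq_ij eqxx in neq_ij.
Qed.

Lemma card_subdomain (i : 'I_m) : #|subdomain i| = n i.
Proof.
have -> : subdomain i = [set tagnat.Rank i k | k : 'I_(n i)].
  apply/setP=> k; rewrite inE; apply/eqP/imsetP => [<-|[l _ ->]].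
    by exists (tagnat.sig2 k); rewrite ?tagnat.sig2K.
  by rewrite tagnat.Rank1K.
rewrite card_imset ?card_ord // => k l /tagnat.rank_inj /eqP.
by rewrite eq_Tagged => /eqP.
Qed.

Lemma subdomain_consecutive (i j : 'I_m) (k l : 'I_(\sum_i n i)%N) :
  k \in subdomain i -> l \in subdomain j -> (i < j)%N -> (k < l)%N.
Proof.
rewrite !inE => /eqP <- /eqP <-; apply: contraTT; rewrite -!leqNgt.
exact: tagnat.le_sig1.
Qed.

End Subdomains.

Section Interface.
Variables (R : realType) (m : nat) (n : 'I_m -> nat).
Variable A : 'M[R]_(\sum_i n i)%N.

Definition adjacent (i j : 'I_m) : bool := (i != j) && (submxblock A i j != 0).

Definition edges : {set 'I_(\sum_i n i)%N * 'I_(\sum_i n i)%N} :=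
  [set e | [exists i : 'I_m, exists j : 'I_m,
     [&& (i < j)%N, e.1 \in subdomain n i, e.2 \in subdomain n j
       & A e.1 e.2 != 0]]].

(* Vectors indexed by edges are indexed by ['I_#|edges|] through [enum_val]. *)
Definition edge (e : 'I_#|edges|) : 'I_(\sum_i n i)%N * 'I_(\sum_i n i)%N :=
  enum_val e.

Definition Wmx : 'M[R]_#|edges| :=
  diag_mx (\row_e A (edge e).1 (edge e).2).

Definition Mmx : 'M[R]_(#|edges|, (\sum_i n i)%N) :=
  \matrix_(e, k) (((k == (edge e).1)%:R + (k == (edge e).2)%:R) / 2).

Lemma mul_Mmx (p : 'cV[R]_(\sum_i n i)%N) (e : 'I_#|edges|) :
  (Mmx *m p) e 0 = (p (edge e).1 0 + p (edge e).2 0) / 2.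
Proof.
have pick N (q : 'cV[R]_N) l : \sum_k (k == l)%:R * q k 0 = q l 0.
  rewrite (bigD1 l) //= eqxx mul1r big1 ?addr0 // => k /negPf->.
  by rewrite mul0r.
rewrite mxE [LHS](eq_bigr (fun k => ((k == (edge e).1)%:R * p k 0 +
  (k == (edge e).2)%:R * p k 0) / 2)); last first.
  by move=> k _; rewrite mxE mulrAC mulrDl.
by rewrite -mulr_suml big_split /= !pick.
Qed.

Definition Dmx (i j : 'I_m) : 'M[R]_(n i) :=
  diag_mx (submxblock A i j *m const_mx 1)^T.

Definition Ablock (i : 'I_m) : 'M[R]_(n i) :=
  submxblock A i i - \sum_(j | adjacent j i) Dmx i j.

Definition Ahat : 'M[R]_(\sum_i n i)%N := \mxdiag_i Ablock i.

Definition Qmx (r : nat) (Z : 'M[R]_(#|edges|, r)) : 'M[R]_((\sum_i n i) + r)%N :=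
  block_mx (4^-1 *: Ahat)        (Mmx^T *m Wmx *m Z)
           (Z^T *m Wmx *m Mmx)   (- (Z^T *m Wmx *m Z)).

End Interface.

(* Main.v *)
(* The coupling of distinct subdomains is carried edge by edge: since
   [2 a p_k p_l + a p_k^2 + a p_l^2 = a (p_k + p_l)^2], one has
   [p^T A p - p^T Ahat p = 4 (M p)^T W (M p)], and expanding the square in
   [lambda - M p] yields the identity.  Positive definiteness follows because
   [dim Lambda = r] forces [Z] to be injective. *)
Require Import Defs.
From mathcomp Require Import all_boot all_order all_algebra.
From mathcomp Require Import reals ring.

Set Implicit Arguments.
Unset Strict Implicit.
Unset Printing Implicit Defensive.

Import Order.TTheory GRing.Theory Num.Theory.

Local Open Scope ring_scope.

Section QuadraticForms.
Variable R : realType.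

Lemma qformE n (B : 'M[R]_n) (x : 'cV[R]_n) :
  qform B x = \sum_k \sum_l B k l * (x k 0 * x l 0).
Proof.
rewrite /qform mxE exchange_big; apply: eq_bigr => l _ /=.
by rewrite mxE mulr_suml; apply: eq_bigr => k _; rewrite mxE mulrCA mulrA.
Qed.

Lemma qform_diag n (d : 'rV[R]_n) (x : 'cV[R]_n) :
  qform (diag_mx d) x = \sum_k d 0 k * x k 0 ^+ 2.
Proof.
rewrite qformE; apply: eq_bigr => k _.
rewrite (bigD1 k) //= mxE eqxx mulr1n big1 ?addr0 // => l /negPf nlk.
by rewrite mxE eq_sym nlk mul0r.
Qed.

Lemma qform0 n (B : 'M[R]_n) : qform B 0 = 0.
Proof. by rewrite /qform mulmx0 mxE. Qed.

Lemma qformN n (B : 'M[R]_n) (x : 'cV[R]_n) : qform (- B) x = - qform B x.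
Proof. by rewrite /qform mulmxN mulNmx mxE. Qed.

Lemma spd_ge0 n (B : 'M[R]_n) (x : 'cV[R]_n) : spd B -> 0 <= qform B x.
Proof.
by case=> _ posB; have [->|/posB/ltW //] := eqVneq x 0; rewrite qform0.
Qed.

(** A 1 by 1 matrix equals its transpose. This is what merges the two cross terms when a square or a
    symmetric block form is expanded. *)
Lemma tr_bilinear m n (B : 'M[R]_(m, n)) (x : 'cV[R]_m) (y : 'cV[R]_n) :
  (y^T *m B^T *m x) 0 0 = (x^T *m B *m y) 0 0.
Proof. by rewrite -[x in LHS]trmxK -!trmx_mul mxE mulmxA. Qed.

Lemma qformB n (B : 'M[R]_n) (x y : 'cV[R]_n) : B^T = B ->
  qform B (x - y) = qform B x - (x^T *m B *m y) 0 0 *+ 2 + qform B y.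
Proof.
move=> symB; have eq_yx : (y^T *m B *m x) 0 0 = (x^T *m B *m y) 0 0.
  by rewrite -tr_bilinear symB.
rewrite /qform [(x - y)^T]linearB /= mulmxBr !mulmxBl.
move: eq_yx; rewrite !mxE => ->; ring.
Qed.

Lemma qform_block n r (B : 'M[R]_n) (C : 'M[R]_(n, r)) (D : 'M[R]_r)
    (p : 'cV[R]_n) (x : 'cV[R]_r) :
  qform (block_mx B C C^T D) (col_mx p x) =
  qform B p + (x^T *m C^T *m p) 0 0 *+ 2 + qform D x.
Proof.
have eq_px := tr_bilinear C p x.
rewrite /qform tr_col_mx mul_row_block mul_row_col !mulmxDl.
move: eq_px; rewrite !mxE => <-; ring.
Qed.

End QuadraticForms.


(** The local indices [a] and [b] have different types until [i = j] is known, so they are compared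
    as natural numbers. *)
Lemma eq_Rank_ord m (n : 'I_m -> nat) i j (a : 'I_(n i)) (b : 'I_(n j)) :
  (tagnat.Rank i a == tagnat.Rank j b) = (i == j) && (a == b :> nat).
Proof. by rewrite -tagnat.eq_Rank. Qed.

Section Interface.
Variables (R : realType) (m : nat) (n : 'I_m -> nat).
Variable A : 'M[R]_(\sum_i n i)%N.
Hypothesis symA : A^T = A.

Lemma sym_entry k l : A k l = A l k.
Proof. by rewrite -{1}symA mxE. Qed.

(** [tagnat.Rank j] is a bijection from the local indices onto subdomain [j]; this moves sums over a
    block to global indices. *)
Lemma sum_Rank (j : 'I_m) (F : 'I_(\sum_i n i)%N -> R) :
  \sum_(b < n j) F (tagnat.Rank j b) = \sum_(u | tagnat.sig1 u == j) F u.
Proof.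
transitivity (\sum_(u in subdomain n j) F u); last first.
  by apply: eq_bigl => u; rewrite inE.
have -> : subdomain n j = [set tagnat.Rank j b | b : 'I_(n j)].
  apply/setP=> k; rewrite inE; apply/eqP/imsetP => [<-|[l _ ->]].
    by exists (tagnat.sig2 k); rewrite ?tagnat.sig2K.
  by rewrite tagnat.Rank1K.
rewrite big_imset //= => k l _ _ /tagnat.rank_inj /eqP.
by rewrite eq_Tagged => /eqP.
Qed.

Lemma mem_edges e :
  (e \in edges A) = (tagnat.sig1 e.1 < tagnat.sig1 e.2)%N && (A e.1 e.2 != 0).
Proof.
rewrite inE; apply/existsP/andP => [[i /existsP[j]]|[lt_e nz_e]].
  by rewrite !inE => /and4P[lt_ij /eqP-> /eqP->].
exists (tagnat.sig1 e.1); apply/existsP; exists (tagnat.sig1 e.2).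
by rewrite !inE !eqxx lt_e nz_e.
Qed.

(** Subdomains that are not adjacent to [i] contribute only zero entries, so the diagonal
    corrections [Dmx i j] together subtract the full row sum outside the diagonal block. *)
Lemma sum_adjacent i (a : 'I_(n i)) :
  \sum_(j | adjacent A j i) \sum_b A (tagnat.Rank i a) (tagnat.Rank j b) =
  \sum_(u | tagnat.sig1 u != i) A (tagnat.Rank i a) u.
Proof.
rewrite (partition_big (@tagnat.sig1 _ n) (fun j => j != i)) //=.
rewrite [RHS](bigID (fun j => submxblock A j i == 0)) /= [X in _ = X + _]big1.
  rewrite add0r; apply: eq_bigr => j /andP[nji _]; rewrite sum_Rank.
  by apply: eq_bigl => u; case: eqP => [->|]; rewrite ?andbF ?nji.
move=> j /andP[_ /eqP A0]; apply: big1 => u /andP[_ /eqP eq_uj].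
(* The vanishing block has its rows in [j], while the summand has its row in [i]: the symmetry of
   [A] links them. *)
subst j; move/matrixP: A0 => /(_ (tagnat.sig2 u) a).
by rewrite !mxE tagnat.sig2K sym_entry.
Qed.

(** This entrywise form in global indices lets all later computations avoid blocks. *)
Lemma AhatE k l : Ahat A k l =
  (tagnat.sig1 k == tagnat.sig1 l)%:R * A k l -
  (k == l)%:R * \sum_(u | tagnat.sig1 u != tagnat.sig1 k) A k u.
Proof.
(* Naming the right-hand side as a matrix allows a comparison block by block. *)
pose B := \matrix_(k, l) ((tagnat.sig1 k == tagnat.sig1 l)%:R * A k l -
  (k == l)%:R * \sum_(u | tagnat.sig1 u != tagnat.sig1 k) A k u).
suff -> : Ahat A = B by rewrite mxE.
apply/mxblockP => i j; apply/matrixP => a b; case: (eqVneq i j) => [eq_ij|nij].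
  subst j; rewrite submxblock_diag !mxE !tagnat.Rank1K eqxx mul1r.
  rewrite summxE -sum_adjacent mulr_sumr; congr (_ - _).
  apply: eq_bigr => j _; rewrite !mxE.
  rewrite eq_Rank_ord eqxx /= mulr_natl.
  congr (_ *+ _); apply: eq_bigr => c _; first by rewrite !mxE mulr1.
rewrite mxblockK (negPf nij) !mxE !tagnat.Rank1K (negPf nij) mul0r.
by rewrite eq_Rank_ord (negPf nij) mul0r subr0.
Qed.

Lemma tr_Wmx : (Wmx A)^T = Wmx A.
Proof. exact: tr_diag_mx. Qed.

Lemma tr_Ahat : (Ahat A)^T = Ahat A.
Proof.
apply/matrixP => k l; rewrite mxE !AhatE (sym_entry l k) eq_sym.
by rewrite [l == k]eq_sym; case: (eqVneq k l) => [->//|_]; rewrite !mul0r.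
Qed.

Lemma qform_Ahat p : qform (Ahat A) p =
  \sum_k \sum_(l | tagnat.sig1 l == tagnat.sig1 k) A k l * (p k 0 * p l 0) -
  \sum_k \sum_(l | tagnat.sig1 l != tagnat.sig1 k) A k l * p k 0 ^+ 2.
Proof.
rewrite qformE -sumrB; apply: eq_bigr => k _.
under [LHS]eq_bigr => l _ do rewrite AhatE mulrBl.
rewrite sumrB; congr (_ - _).
  rewrite [RHS]big_mkcond; apply: eq_bigr => l _; rewrite eq_sym.
  by case: eqP; rewrite ?mul1r ?mul0r.
rewrite (bigD1 k) //= eqxx mul1r [X in _ + X]big1 ?addr0.
  by rewrite mulr_suml.
by move=> l /negPf nlk; rewrite eq_sym nlk !mul0r.
Qed.

(** Couplings inside a subdomain cancel. What is left runs over ordered pairs, so each coupling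
    still occurs in both orders. *)
Lemma qform_sub_Ahat p : qform A p - qform (Ahat A) p =
  \sum_k \sum_(l | tagnat.sig1 l != tagnat.sig1 k)
    A k l * (p k 0 * p l 0 + p k 0 ^+ 2).
Proof.
rewrite qform_Ahat qformE opprB addrCA -sumrB -big_split; apply: eq_bigr => k _ /=.
rewrite [X in _ + (X - _)](bigID (fun l => tagnat.sig1 l == tagnat.sig1 k)) /=.
rewrite addrAC subrr add0r -big_split; apply: eq_bigr => l _ /=; ring.
Qed.

(** The factor [4^-1] is the square of the one half in the average. Pairs with a zero entry are not
    edges but add nothing, so the sum may run over all of them. *)
Lemma qform_Wmx_Mmx p : qform (Wmx A) (Mmx A *m p) =
  4^-1 * \sum_k \sum_(l | (tagnat.sig1 k < tagnat.sig1 l)%N)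
    A k l * (p k 0 + p l 0) ^+ 2.
Proof.
rewrite qform_diag.
pose F e := 4^-1 * (A e.1 e.2 * (p e.1 0 + p e.2 0) ^+ 2).
rewrite (eq_bigr (fun e => F (edge e))) => [|e _]; last first.
  by rewrite mul_Mmx mxE /F; field.
rewrite /edge -(big_enum_val F).
rewrite pair_big_dep mulr_sumr [RHS](bigID (fun e => A e.1 e.2 != 0)) /=.
rewrite [X in _ + X]big1 ?addr0; first by apply: eq_bigl => e; rewrite mem_edges.
by move=> e /andP[_ /negPn/eqP->]; rewrite mul0r mulr0.
Qed.

(** The orders [(k, l)] and [(l, k)] contribute [a (p_k p_l + p_k^2)] and [a (p_k p_l + p_l^2)],
    which add up to [a (p_k + p_l)^2]. *)
Lemma qform_interface p :
  qform A p - qform (Ahat A) p = 4 * qform (Wmx A) (Mmx A *m p).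
Proof.
rewrite qform_Wmx_Mmx mulVKf ?pnatr_eq0 // qform_sub_Ahat.
pose f k l := A k l * (p k 0 * p l 0 + p k 0 ^+ 2).
have -> : \sum_k \sum_(l | tagnat.sig1 l != tagnat.sig1 k) f k l =
  \sum_k \sum_(l | (tagnat.sig1 k < tagnat.sig1 l)%N) f k l +
  \sum_k \sum_(l | (tagnat.sig1 l < tagnat.sig1 k)%N) f k l.
  rewrite -big_split; apply: eq_bigr => k _ /=.
  rewrite (bigID (fun l => (tagnat.sig1 k < tagnat.sig1 l)%N)) /=.
  by congr (_ + _); apply: eq_bigl => l; rewrite -val_eqE /=; case: ltngtP.
(* Exchanging the sums swaps the roles of [k] and [l], so that both sums range over the same
   pairs. *)
rewrite [X in _ + X](exchange_big_dep predT) //= -big_split.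
apply: eq_bigr => k _; rewrite -big_split; apply: eq_bigr => l _ /=.
rewrite /f (sym_entry l k); ring.
Qed.

Lemma tr_Qmx r (Z : 'M[R]_(#|edges A|, r)) : (Qmx Z)^T = Qmx Z.
Proof.
rewrite /Qmx tr_block_mx linearZ /= linearN /= tr_Ahat.
by rewrite !trmx_mul !trmxK tr_Wmx !mulmxA.
Qed.

Lemma qform_Qmx r (Z : 'M[R]_(#|edges A|, r)) p eta :
  qform (Qmx Z) (col_mx p eta) =
  4^-1 * qform A p - qform (Wmx A) (Z *m eta - Mmx A *m p).
Proof.
(* [qform_block] expects the lower left block as the transpose of the upper right one. *)
have eqC : Z^T *m Wmx A *m Mmx A = ((Mmx A)^T *m Wmx A *m Z)^T.
  by rewrite !trmx_mul trmxK tr_Wmx mulmxA.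
rewrite /Qmx eqC qform_block -eqC qformB ?tr_Wmx // qformN.
have -> : qform (Z^T *m Wmx A *m Z) eta = qform (Wmx A) (Z *m eta).
  by rewrite /qform trmx_mul !mulmxA.
have -> : qform (4^-1 *: Ahat A) p = 4^-1 * qform (Ahat A) p.
  by rewrite /qform -scalemxAr -scalemxAl mxE.
rewrite trmx_mul !mulmxA; have := qform_interface p.
by move/(canRL (subrK _)) => ->; field.
Qed.

End Interface.

(** By rank-nullity, an image of the same dimension [r] as the domain leaves a kernel of dimension
    0. *)
Lemma limg_mulmx_inj (R : realType) q r (Z : 'M[R]_(q, r)) :
  \dim (limg (linfun (mulmx Z : 'cV[R]_r -> 'cV[R]_q))) = r ->
  injective (mulmx Z : 'cV[R]_r -> 'cV[R]_q).
Proof.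
move=> dimZ; set f := linfun _ in dimZ.
suff /lker0P injf : lker f == 0%VS.
  by move=> x y eqZ; apply: injf; rewrite !lfunE.
have := limg_ker_dim f fullv.
rewrite dimZ capfv dimvf /dim /= muln1 -[RHS]add0n => /addIn/eqP.
by rewrite dimv_eq0.
Qed.

Theorem theorem4p4 (R : realType) (m : nat) (n : 'I_m -> nat)
    (A : 'M[R]_(\sum_i n i)%N) (hA : spd A) (hW : spd (- Wmx A))
    (r : nat) (Lambda : {vspace 'cV[R]_#|edges A|}) (hLambda : \dim Lambda = r)
    (Z : 'M[R]_(#|edges A|, r))
    (hZ : limg (linfun (mulmx Z : 'cV[R]_r -> 'cV[R]_#|edges A|)) = Lambda) :
  (forall (p : 'cV[R]_(\sum_i n i)%N) (eta : 'cV[R]_r),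
     let lambda := Z *m eta in
     qform (Qmx Z) (col_mx p eta) =
       4^-1 * qform A p - qform (Wmx A) (lambda - Mmx A *m p)) /\
  spd (Qmx Z).
Proof.
split=> [p eta /=|]; first exact: (qform_Qmx hA.1).
split=> [|x]; first exact: (tr_Qmx hA.1).
rewrite -[x]vsubmxK; set p := usubmx x; set eta := dsubmx x => nz.
rewrite (qform_Qmx hA.1) -qformN.
(* If [p] is nonzero, the [A] term is positive and the [- Wmx A] term nonnegative. If [p] is 0, then
   [eta] is nonzero, hence so is [Z *m eta], and [- Wmx A] gives positivity. *)
have [p0|nz_p] := eqVneq p 0; last first.
  apply: ltr_wpDr; first exact: spd_ge0.
  by rewrite mulr_gt0 ?invr_gt0 ?ltr0n // hA.2.
rewrite p0 qform0 mulr0 add0r mulmx0 subr0 hW.2 //.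
apply: contraNneq nz => Z0; rewrite p0.
suff -> : eta = 0 by rewrite col_mx0.
by apply: (@limg_mulmx_inj _ _ _ Z); rewrite ?hZ // mulmx0.
Qed.
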